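(* Let $X$ and $Y$ be infinite compact spaces, $Z$ a metrizable space, and $K$ a compact subspace of $S(X\times Y,Z)$. Then $w(K)<\min\{c^\sharp(X),c^\sharp(Y)\}$.
   Context: All compact spaces are assumed Hausdorff. For topological spaces $X,Y,Z$, a function $f:X\times Y\to Z$ is separately continuous if $y\mapsto f(x,y)$ is continuous for every $x\in X$ and $x\mapsto f(x,y)$ is continuous for every $y\in Y$. $S(X\times Y,Z)$ denotes the set of all separately continuous functions $X\times Y\to Z$. For $p=(a,b)\in X\times Y$, the cross of $p$ is $\mathrm{cr}\{p\}=(\{a\}\times Y)\cup(X\times\{b\})$. For $X,Y$ compact and $Z$ metrizable with a compatible metric $d$, $S(X\times Y,Z)$ carries the topology generated by the family of extended pseudometrics $d_c(s,t)=\sup_{p\in\mathrm{cr}\{c\}} d(s(p),t(p))$, $c\in X\times Y$ (the cross-uniform topology); it coincides with the cross-open topology, generated by the subbase of sets $\{s: s(A)\subseteq W\}$ with $W$ open in $Z$ and $A=\overline{G}\cap C$, where $C=\mathrm{cr}\{p\}$ for some $p$ and $G$ is open in $C$. $w(K)$ is the weight of $K$. The sharp cellularity is $c^\sharp(X)=\sup\{|\mathcal U|^+:\mathcal U$ a family of pairwise disjoint open sets in $X\}$, where $\mathfrak m^+$ denotes the least cardinal greater than $\mathfrak m$. *)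

(* Defs.v *)
From HB Require Import structures.
From mathcomp Require Import all_boot all_order all_algebra.
From mathcomp Require Import all_classical all_reals all_analysis.
Set Implicit Arguments. Unset Strict Implicit. Unset Printing Implicit Defensive.
Import Order.TTheory GRing.Theory Num.Theory.
Local Open Scope classical_set_scope.
Local Open Scope ring_scope.

(* A metric on Z (Z metrizable = Z carries the topology of some metric d). *)
Definition is_metric {R : realType} {Z : Type} (d : Z -> Z -> R) : Prop :=
  (forall x, d x x = 0) /\ (forall x y, d x y = 0 -> x = y) /\
  (forall x y, d x y = d y x) /\ (forall x y z, d x z <= d x y + d y z).

Definition mcont {R : realType} {T : topologicalType} {Z : Type}
  (d : Z -> Z -> R) (f : T -> Z) : Prop :=
  forall x (eps : R), 0 < eps -> \forall y \near x, d (f x) (f y) < eps.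

Definition sepcont {R : realType} {X Y : topologicalType} {Z : Type}
  (d : Z -> Z -> R) (s : X * Y -> Z) : Prop :=
  (forall x : X, mcont d (fun y : Y => s (x, y))) /\
  (forall y : Y, mcont d (fun x : X => s (x, y))).

Definition Ssep {R : realType} {X Y : topologicalType} {Z : Type}
  (d : Z -> Z -> R) : set (X * Y -> Z) := [set s | sepcont d s].

Definition cross {X Y : Type} (p : X * Y) : set (X * Y) :=
  [set q | q.1 = p.1 \/ q.2 = p.2].

Definition dcross {R : realType} {X Y : Type} {Z : Type}
  (d : Z -> Z -> R) (c : X * Y) (s t : X * Y -> Z) : \bar R :=
  ereal_sup [set (d (s p) (t p))%:E | p in cross c].

(* open sets of S(X x Y, Z) for the cross-uniform topology, i.e. the topology
   generated by the family of extended pseudometrics d_c *)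
Definition cu_open {R : realType} {X Y : topologicalType} {Z : Type}
  (d : Z -> Z -> R) (W : set (X * Y -> Z)) : Prop :=
  W `<=` Ssep d /\
  forall s, W s -> exists (F : seq (X * Y)) (eps : R), 0 < eps /\
    [set t | Ssep d t /\ forall c, c \in F -> (dcross d c s t < eps%:E)%E]
      `<=` W.

Definition cu_compact {R : realType} {X Y : topologicalType} {Z : Type}
  (d : Z -> Z -> R) (K : set (X * Y -> Z)) : Prop :=
  K `<=` Ssep d /\
  forall (I : Type) (W : I -> set (X * Y -> Z)),
    (forall i, cu_open d (W i)) -> K `<=` \bigcup_i W i ->
    exists2 F : set I, finite_set F & K `<=` \bigcup_(i in F) W i.

Definition cu_base_of {R : realType} {X Y : topologicalType} {Z : Type}
  (d : Z -> Z -> R) (K : set (X * Y -> Z)) (B : set (set (X * Y -> Z))) : Prop :=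
  (forall b, B b -> exists W, cu_open d W /\ b = K `&` W) /\
  (forall W, cu_open d W -> forall s, (K `&` W) s ->
     exists2 b, B b & b s /\ b `<=` K `&` W).

Definition cellular_family {T : topologicalType} (U : set (set T)) : Prop :=
  (forall u, U u -> open u) /\
  (forall u v, U u -> U v -> u <> v -> u `&` v = set0).

(* Main.v *)
(* Idea.  Let e(s, x, y) = s(x, y) for s in K.  For each x, e(., x, .) is
   continuous on the compact space K * Y, so that e is separately continuous on
   X * (K * Y) and Namioka's theorem applies: every nonempty open subset of X
   contains a nonempty open set on which e(s, ., y) oscillates by at most 1/n,
   uniformly in (s, y).  Take a maximal cellular family F_n of such sets and a
   point in each of them; by maximality the union of F_n is dense, so that the
   pseudometrics sup_y d(s(x, y), t(x, y)), for these points x and all n,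
   separate K.  As K is compact, finitely many balls of radius 1/m for each of
   these pseudometrics and each m generate the topology, whence a base of
   cardinality at most that of the finite sequences over the union of the F_n.

   It remains to find one cellular family V with |F_n| <= |V| for all n, the
   countable case of the Erdos-Tarski theorem that c# is attained unless it is
   weakly inaccessible.  Call an open set good for n if it contains a cellular
   family of size at least |F_n|.  Either some open set has all its open subsets
   good for all n, and V is obtained from infinitely many disjoint ones; or
   there is a maximal cellular family W of sets each bad for some n, and then
   either V is collected inside the members of W, or all members of W are bad
   for a common m and |F_n| <= |W| * |F_m|.

   The same argument in Y gives another base of K; cardinals being comparable,
   the smaller of the two bases serves for both X and Y. *)
Require Import Defs.
From HB Require Import structures.
From mathcomp Require Import all_boot all_order all_algebra.
From mathcomp Require Import all_classical all_reals all_analysis.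
From mathcomp Require Import lra.
Import Order.TTheory GRing.Theory Num.Theory.
Local Open Scope classical_set_scope.
Local Open Scope card_scope.
Set Implicit Arguments.
Unset Strict Implicit.
Unset Printing Implicit Defensive.

(** * Cardinal arithmetic *)

(** Injections are given as relations, total on [A] and injective there, which avoids prescribing
    values off [A]; choice extracts a function. *)
Lemma card_le_rel {T U : Type} (A : set T) (B : set U) (G : T -> U -> Prop) :
  (forall a, A a -> exists2 b, B b & G a b) ->
  (forall a a' b, A a -> A a' -> G a b -> G a' b -> a = a') ->
  A #<= B.
Proof.
move=> GA Ginj; have [->|/set0P[a0 /GA[b0 _ _]]] := eqVneq A set0; first exact: card_ge0.
have /choice[f fP] (a : T) : exists b, A a -> B b /\ G a b.
  by have [/GA[b Bb Gab]|nAa] := pselect (A a); [exists b|exists b0].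
apply/card_leP; have : $|{injfun A >-> B}|.
  apply/injfunPex; exists f => [a /fP[]//|a a' /set_mem Aa /set_mem Aa' eqf].
  by apply: (Ginj a a' (f a)) => //; [case: (fP a)|rewrite eqf; case: (fP a')].
by move=> [g]; exact/card_leP/inj_card_le.
Qed.

Lemma card_leE {T U : Type} (A : set T) (B : set U) : A #<= B -> B !=set0 ->
  exists2 f : T -> U, set_fun A B f & set_inj A f.
Proof.
elim/Ppointed: U => U in B * => AB [b Bb]; first by rewrite emptyE in Bb.
by apply/injfunPex; exact/pcard_leP.
Qed.

(** The relational form also covers an empty [B], where no function on [T] need exist. *)
Lemma card_leE_rel {T U : Type} (A : set T) (B : set U) : A #<= B ->
  exists G : T -> U -> Prop, (forall a, A a -> exists2 b, B b & G a b) /\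
  (forall a a' b, A a -> A a' -> G a b -> G a' b -> a = a').
Proof.
have [->|/set0P B0 AB] := eqVneq B set0.
  by rewrite card_le0 => /eqP ->; exists (fun _ _ => False).
have [f fAB finj] := card_leE AB B0; exists (fun a b => b = f a).
split=> [a /fAB|a a' b Aa Aa' -> /esym eqf]; first by exists (f a).
by apply: finj; rewrite ?inE.
Qed.

Lemma card_le_total {T U : Type} (A : set T) (B : set U) : A #<= B \/ B #<= A.
Proof.
pose P (G : set (T * U)) := G `<=` A `*` B /\
  (forall p q, G p -> G q -> (p.1 = q.1 <-> p.2 = q.2)).
have [G [[GAB Gbij] Gmax]] : exists G, P G /\ forall H, G `<` H -> ~ P H.
  apply: Zorn_bigcup => F FP totF; split.
    by apply: bigcup_sub => H /FP[].
  move=> p q [H FH Hp] [H' FH' H'q].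
  have [sHH'|sH'H] := totF _ _ FH FH'.
    by have [_] := FP _ FH'; apply=> //; exact: sHH'.
  by have [_] := FP _ FH; apply=> //; exact: sH'H.
have [[a [Aa aG]]|/forallNP AG] := pselect (exists a, A a /\ forall b, ~ G (a, b)); last first.
  left; apply: (@card_le_rel _ _ _ _ (fun a b => G (a, b))) => [a Aa|a a' b _ _].
    have := AG a; rewrite not_andP => -[//|/existsNP[b /contrapT Gab]].
    by exists b => //; have /GAB[] := Gab.
  by move=> Gab Ga'b; exact: (Gbij _ _ Gab Ga'b).2.
have [[b [Bb bG]]|/forallNP BG] := pselect (exists b, B b /\ forall a, ~ G (a, b)); last first.
  right; apply: (@card_le_rel _ _ _ _ (fun b a => G (a, b))) => [b Bb|b b' c _ _].
    have := BG b; rewrite not_andP => -[//|/existsNP[c /contrapT Gcb]].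
    by exists c => //; have /GAB[] := Gcb.
  by move=> Gab Ga'b; exact: (Gbij _ _ Gab Ga'b).1.
exfalso; apply: (Gmax (G `|` [set (a, b)])).
  split; last by move=> /(_ (a, b)) /(_ (or_intror erefl)) /aG.
  by move=> p Gp; left.
split=> [p [/GAB//|->//]|[p1 p2] [q1 q2] [Gp|[-> ->]] [Gq|[-> ->]]//=].
- exact: Gbij Gp Gq.
- by split=> E; [move: Gp; rewrite E => /aG|move: Gp; rewrite E => /bG].
- by split=> E; [move: Gq; rewrite -E => /aG|move: Gq; rewrite -E => /bG].
Qed.

Lemma card_le_setX {T T' U U' : Type} (A : set T) (A' : set T') (B : set U)
  (B' : set U') : A #<= B -> A' #<= B' -> A `*` A' #<= B `*` B'.
Proof.
move=> /card_leE_rel[G [GA Ginj]] /card_leE_rel[G' [GA' Ginj']].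
apply: (@card_le_rel _ _ _ _ (fun p q => G p.1 q.1 /\ G' p.2 q.2)).
  by move=> [a a'] [/= /GA[b Bb ?] /GA'[b' Bb' ?]]; exists (b, b').
move=> [a1 a1'] [a2 a2'] [b b'] [/= Aa1 Aa1'] [/= Aa2 Aa2'] [/= ? ?] [/= ? ?].
by congr pair; [apply: (Ginj _ _ b)|apply: (Ginj' _ _ b')].
Qed.

Lemma infinite_set_nat_inj {T : Type} (A : set T) : infinite_set A ->
  exists2 f : nat -> T, (forall n, A (f n)) & injective f.
Proof.
move=> iA; have /card_leE[|f fA finj] := (infiniteP A).1 iA.
  exact: infinite_setN0.
exists f => [n|i j]; first exact: fA.
by apply: finj; rewrite inE.
Qed.

(** Two distinct elements of [C] tag the two sets, which embeds the union into [C * C]. *)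
Lemma card_le_setU {T U : Type} (A B : set T) (C : set U) : infinite_set C ->
  C `*` C #<= C -> A #<= C -> B #<= C -> A `|` B #<= C.
Proof.
move=> iC CC AC BC; apply: card_le_trans CC.
have [c cC cinj] := infinite_set_nat_inj iC.
have C0 : C !=set0 by exists (c 0%N).
have [f fC finj] := card_leE AC C0; have [g gC ginj] := card_leE BC C0.
have c01 : c 0%N <> c 1%N by move/cinj.
apply: (@card_le_rel _ _ _ _ (fun x p =>
  A x /\ p = (f x, c 0%N) \/ B x /\ p = (g x, c 1%N))).
  move=> x [Ax|Bx]; [exists (f x, c 0%N); last by left|
                     exists (g x, c 1%N); last by right].
  - by split; [exact: fC|exact: cC].
  - by split; [exact: gC|exact: cC].
move=> x y p _ _ [[Ax ->]|[Bx ->]] [[Ay]|[By]].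
- by move=> [eqf]; apply: finj; rewrite ?inE.
- by move=> [_ e]; case: c01.
- by move=> [_ e]; case: c01.
- by move=> [eqg]; apply: ginj; rewrite ?inE.
Qed.

(* Zorn on the graphs [G] of injections S * S -> S with S a subset of [A]; the
   union with [G0], the graph on a countable subset, makes the empty chain
   harmless.  If A \ S had a copy S' of S, a maximal injection could be extended
   by an injection of the new pairs of S u S' into S'. *)
Lemma card_le_setX_idem {T : Type} (A : set T) : infinite_set A ->
  A `*` A #<= A.
Proof.
move=> iA; have [f fA finj] := infinite_set_nat_inj iA.
have [g ginj] : exists g : nat * nat -> nat, injective g.
  by exists pickle; exact: (pcan_inj (@pickleK _)).
pose fld (G : set (T * T * T)) := [set x | exists z, G (x, x, z)].
pose Q (G : set (T * T * T)) :=
  [/\ forall p q, G p -> G q -> (p.1 = q.1 <-> p.2 = q.2),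
      forall x y z, G (x, y, z) -> [/\ fld G x, fld G y & fld G z],
      forall x y, fld G x -> fld G y -> exists z, G (x, y, z) &
      fld G `<=` A].
pose G0 : set (T * T * T) := [set p | exists i j, p = (f i, f j, f (g (i, j)))].
have Q0 : Q G0.
  have fld0 i : fld G0 (f i) by exists (f (g (i, i))), i, i.
  split.
  - move=> p q [i [j ->]] [k [l ->]] /=; split.
      by move=> [/finj -> /finj ->].
    by move=> /finj/ginj[-> ->].
  - by move=> x y z [i [j [-> -> ->]]].
  - move=> x y [z [i [j [-> _ _]]]] [z' [k [l [-> _ _]]]].
    by exists (f (g (i, k))), i, k.
  - by move=> x [z [i [j [-> _ _]]]].
have [G [QG Gmax]] : exists G, Q (G0 `|` G) /\ forall H, G `<` H -> ~ Q (G0 `|` H).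
  apply: (@Zorn_bigcup _ (fun G => Q (G0 `|` G))) => F FP totF.
  set U := \bigcup_(X in F) X.
  have sub2 p q : (G0 `|` U) p -> (G0 `|` U) q ->
      exists H, [/\ Q H, H `<=` G0 `|` U, H p & H q].
    have sub X : F X -> G0 `|` X `<=` G0 `|` U.
      by move=> FX r [?|Xr]; [left|right; exists X].
    move=> [G0p|[X FX Xp]] [G0q|[Y FY Yq]].
    - by exists G0; split => // r; left.
    - by exists (G0 `|` Y); split; [exact: FP|exact: sub|left|right].
    - by exists (G0 `|` X); split; [exact: FP|exact: sub|right|left].
    - have [XY|YX] := totF _ _ FX FY.
        by exists (G0 `|` Y); split; [exact: FP|exact: sub|right; exact: XY|right].
      by exists (G0 `|` X); split; [exact: FP|exact: sub|right|right; exact: YX].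
  split.
  - move=> p q Up Uq; have [H [[QH _ _ _] _ Hp Hq]] := sub2 _ _ Up Uq.
    exact: QH.
  - move=> x y z Up; have [H [[_ QH _ _] HU Hp _]] := sub2 _ _ Up Up.
    have [[a Ha] [b Hb] [c Hc]] := QH _ _ _ Hp.
    by split; [exists a|exists b|exists c]; exact: HU.
  - move=> x y [a Ua] [b Ub]; have [H [[_ _ QH _] HU Ha Hb]] := sub2 _ _ Ua Ub.
    have [z Hz] : exists z, H (x, y, z) by apply: QH; [exists a|exists b].
    by exists z; exact: HU.
  - move=> x [a Ua]; have [H [[_ _ _ QH] HU Ha _]] := sub2 _ _ Ua Ua.
    by apply: QH; exists a.
set H := G0 `|` G in QG; set S := fld H.
have [Hbij Hfld Htot SA] := QG.
have Sf i : S (f i) by exists (f (g (i, i))); left; exists i, i.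
have iS : infinite_set S.
  apply/infiniteP; apply: (@card_le_rel _ _ _ _ (fun i x => x = f i)) => [i _|i j x _ _ ->].
    by exists (f i).
  exact: finj.
have SS : S `*` S #<= S.
  apply: (@card_le_rel _ _ _ _ (fun p z => H (p, z))).
    by move=> [x y] [Sx Sy]; have [z Hz] := Htot _ _ Sx Sy; exists z => //;
      have [] := Hfld _ _ _ Hz.
  by move=> p q z _ _ Hp Hq; exact: (Hbij _ _ Hp Hq).2.
(* If [A \ S] is no larger than [S], neither is [A], which then inherits the inequality from [SS];
   otherwise [A \ S] contains a copy of [S]. *)
have [ASS|SAS] := card_le_total (A `\` S) S.
  have AS : A #<= S.
    apply: (@card_le_trans _ _ _ (S `|` (A `\` S))).
      apply: subset_card_le => x Ax.
      by have [?|?] := pselect (S x); [left|right].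
    exact: card_le_setU.
  apply: (card_le_trans (card_le_setX AS AS)).
  by apply: (card_le_trans SS); exact: subset_card_le.
have [psi psiAS psiinj] : exists2 h : T -> T, set_fun S (A `\` S) h & set_inj S h.
  apply: card_leE => //; apply: infinite_setN0; apply/infiniteP.
  by apply: card_le_trans SAS; exact/infiniteP.
pose S' := psi @` S.
have S'S : S' `&` S = set0 by apply/seteqP; split=> // x [[y /psiAS[_ nS] <-]].
have S'leS : S' #<= S by exact: card_image_le.
have SleS' : S #<= S'.
  apply: (@card_le_rel _ _ _ _ (fun x y => y = psi x)) => [x Sx|x y z Sx Sy -> e].
    by exists (psi x) => //; exists x.
  by apply: psiinj; rewrite ?inE.
have W : S `|` S' #<= S by exact: card_le_setU.
have [h hS' hinj] : exists2 h : T * T -> T,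
    set_fun ((S `|` S') `*` (S `|` S')) S' h & set_inj ((S `|` S') `*` (S `|` S')) h.
  apply: card_leE; last by exists (psi (f 0%N)), (f 0%N).
  by apply: (card_le_trans (card_le_setX W W)); exact: card_le_trans SS SleS'.
pose N : set (T * T * T) := [set p | [/\ ((S `|` S') `*` (S `|` S')) p.1,
  ~ (S p.1.1 /\ S p.1.2) & p.2 = h p.1]].
have disj x : S x -> S' x -> False.
  by move=> Sx S'x; have : (S' `&` S) x by []; rewrite S'S.
exfalso; apply: (Gmax (G `|` N)).
  split; first by move=> p; left.
  (* The extension is proper: it has a value at [(x, x)], whereas [x] lies in [S'], hence outside
     [S]. *)
  pose x := psi (f 0%N); have S'x : S' x by exists (f 0%N).
  move=> /(_ (x, x, h (x, x))) Gx.
  apply: (@disj x) => //; exists (h (x, x)); right; apply: Gx; right.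
  by split=> //=; [split; right|move=> [/disj]].
rewrite setUA -/H.
have fldN x : fld (H `|` N) x <-> (S `|` S') x.
  split=> [[z [Hx|[[]]//]]|[[z Hz]|S'x]]; first by left; exists z.
    by exists z; left.
  exists (h (x, x)); right; split=> //=; first by split; right.
  by move=> [/disj].
split.
- move=> [[p1 p2] p3] [[q1 q2] q3] [Hp|[/= Np nSp ->]] [Hq|[/= Nq nSq ->]].
  + exact: Hbij.
  + have [Sp1 Sp2 Sp3] := Hfld _ _ _ Hp; split=> /= E.
      by case: nSq; case: E => <- <-.
    by case: (@disj p3) => //; rewrite E; exact: hS'.
  + have [Sp1 Sp2 Sp3] := Hfld _ _ _ Hq; split=> /= E.
      by case: nSp; case: E => -> ->.
    by case: (@disj q3) => //; rewrite -E; exact: hS'.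
  + by split=> /= [->//|]; apply: hinj; rewrite inE.
- move=> x y z [/Hfld[? ? ?]|[[/= ? ?] _ ->]].
    by split; apply/fldN; left.
  by split; apply/fldN => //; right; apply: hS'.
- move=> x y /fldN Sx /fldN Sy.
  have [[Sx' Sy']|nS] := pselect (S x /\ S y).
    by have [z Hz] := Htot _ _ Sx' Sy'; exists z; left.
  by exists (h (x, y)); right.
- move=> x /fldN[/SA//|[y Sy <-]].
  by have [] := psiAS y Sy.
Qed.

(** A sequence is coded by iterating an injection of pairs into [B]. The length is coded as well,
    because the code [c 0] of the empty sequence may also arise from a longer one. *)
Lemma card_le_seq {T : eqType} {U : Type} (A : set T) (B : set U) : infinite_set B ->
  A #<= B -> [set s : seq T | forall x, x \in s -> A x] #<= B.
Proof.
move=> iB AB.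
have [c cB cinj] := infinite_set_nat_inj iB.
have B0 : B !=set0 by exists (c 0%N).
have [f fB finj] := card_leE AB B0.
have [m mB minj] := card_leE (card_le_setX_idem iB) B0.
pose enc := foldr (fun x b => m (f x, b)) (c 0%N).
have encB s : (forall x, x \in s -> A x) -> B (enc s).
  elim: s => [_|x s IH As]; first exact: cB.
  apply: mB; split; first by apply: fB; apply: As; rewrite mem_head.
  by apply: IH => y ys; apply: As; rewrite in_cons ys orbT.
apply: (@card_le_rel _ _ _ _ (fun s b => b = m (c (size s), enc s))).
  by move=> s As; exists (m (c (size s), enc s)) => //; apply: mB; split; [exact: cB|exact: encB].
move=> s t b As At ->.
move=> /minj; rewrite !inE => /(_ (conj (cB _) (encB _ As)) (conj (cB _) (encB _ At))).
move=> [/cinj]; elim: s t {b} As At => [[|]//|x s IH [//|y t] /= As At [sz]].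
have Ass z : z \in s -> A z by move=> zs; apply: As; rewrite in_cons zs orbT.
have Att z : z \in t -> A z by move=> zt; apply: At; rewrite in_cons zt orbT.
have Ax : A x by apply: As; rewrite mem_head.
have Ay : A y by apply: At; rewrite mem_head.
move=> /minj; rewrite !inE => /(_ (conj (fB _ Ax) (encB _ Ass))).
move=> /(_ (conj (fB _ Ay) (encB _ Att))) [exy /(IH _ Ass Att sz) ->].
by congr cons; apply: finj; rewrite ?inE.
Qed.

(** * Cellular families *)

(** Maximality gives density: an open set missing every member would contain an admissible set that
    could be added. *)
Lemma max_cellular_family {T : topologicalType} (P : set (set T)) :
  (forall G, open G -> G !=set0 ->
     exists u, [/\ open u, u !=set0, u `<=` G & P u]) ->
  exists W : set (set T), [/\ cellular_family W, forall w, W w -> w !=set0 /\ P w &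
     forall G, open G -> G !=set0 -> exists2 w, W w & (G `&` w) !=set0].
Proof.
move=> HP; pose D : set (set T) := [set u | [/\ open u, u !=set0 & P u]].
have [W [WD trivW maxW]] := ex_maximal_disjoint_subcollection id D.
exists W; split.
- split=> [u /WD[]//|u v Wu Wv uv]; apply: contrapT => /eqP/set0P uv0.
  by apply: uv; exact: trivW.
- by move=> w /WD[].
- move=> G oG G0; apply: contrapT => /forall2NP GW.
  have [u [ou u0 uG Pu]] := HP _ oG G0.
  have uW w : W w -> (u `&` w) !=set0 -> False.
    move=> Ww [x [ux wx]]; case: (GW w) => // -[].
    by exists x; split=> //; exact: uG.
  have Wu : ~ W u by move=> /uW; rewrite setIid; exact.
  apply: (maxW (W `|` [set u])).
  + split; first by move=> w; left.
    by move=> /(_ u) /(_ (or_intror erefl)).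
  + by move=> w [/WD//|->].
  + move=> v w [Wv|->] [Ww|->] //= vw.
    * exact: trivW.
    * by case: (uW v) => //; rewrite setIC.
    * by case: (uW w).
Qed.

Definition cellular_in {T : topologicalType} (G : set T) (V : set (set T)) :=
  cellular_family V /\ forall v, V v -> v !=set0 /\ v `<=` G.

Lemma cellular_bigcup {T : topologicalType} {I : Type} (D : set I)
  (w : I -> set T) (F : I -> set (set T)) :
  (forall i j, D i -> D j -> i <> j -> w i `&` w j = set0) ->
  (forall i, D i -> cellular_in (w i) (F i)) ->
  cellular_family (\bigcup_(i in D) F i).
Proof.
move=> disj HF; split=> [u [i /HF[[oF _] _] /oF//]|].
move=> u v [i Di Fu] [j Dj Fv] uv.
have [ij|/(disj _ _ Di Dj) ij0] := pselect (i = j).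
  by rewrite -ij in Fv; have [[_ +] _] := HF _ Di; exact.
rewrite -subset0 -ij0 => x [ux vx].
by split; [have [_ /(_ _ Fu)[_]] := HF _ Di|have [_ /(_ _ Fv)[_]] := HF _ Dj]; exact.
Qed.

Lemma cellular_upper_bound {T : topologicalType} (U : nat -> set (set T)) :
  (forall n, cellular_in setT (U n)) -> (forall n, U n #<= U n.+1) ->
  infinite_set (U 0%N) ->
  exists2 V : set (set T), cellular_family V & forall n, U n #<= V.
Proof.
move=> cU leU iU0.
have Umono m n : (m <= n)%N -> U m #<= U n.
  elim: n => [|n IH]; first by rewrite leqn0 => /eqP ->; exact: card_lexx.
  rewrite leq_eqVlt => /orP[/eqP ->|/IH mn]; first exact: card_lexx.
  exact: card_le_trans (leU n).
pose good n G := exists2 V : set (set T), cellular_in G V & U n #<= V.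
have goodW m n G : (m <= n)%N -> good n G -> good m G.
  by move=> mn [V ? ?]; exists V => //; exact: card_le_trans (Umono _ _ mn) _.
have [[G [oG G0 Ggood]]|noG] := pselect (exists G, [/\ open G, G !=set0 &
    forall H, open H -> H !=set0 -> H `<=` G -> forall n, good n H]).
  have [V0 [[oV0 dV0] V0G] UV0] := Ggood G oG G0 (fun _ => id) 0%N.
  have iV0 : infinite_set V0.
    by apply/infiniteP; apply: card_le_trans UV0; exact/infiniteP.
  have [v vV0 vinj] := infinite_set_nat_inj iV0.
  (* The [n]-th of infinitely many disjoint open sets carries a family as large as [U n]; the union
     of these families bounds every [U n]. *)
  have /choice[F HF] n : exists F : set (set T), cellular_in (v n) F /\ U n #<= F.
    have [v0 vG] := V0G _ (vV0 n).
    by have [F] := Ggood _ (oV0 _ (vV0 n)) v0 vG n; exists F.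
  exists (\bigcup_n F n).
    apply: (cellular_bigcup (w := v)) => [i j _ _ ij|i _]; last by have [] := HF i.
    by apply: dV0 => // /vinj.
  move=> n; have [_ /card_le_trans] := HF n; apply.
  by apply: subset_card_le => u; exists n.
pose bad G := exists n, ~ good n G.
have [G oG G0|W [[oW dW] Wbad Wdense]] := @max_cellular_family T bad.
  apply: contrapT => nG; apply: noG; exists G; split=> // H oH H0 HG n.
  by apply: contrapT => nH; apply: nG; exists H; split=> //; exists n.
have [|/existsNP[m]] := pselect (forall m, exists2 w, W w & good m w).
  move=> Wgood.
  have /choice[F HF] w : exists F : set (set T), W w ->
      cellular_in w F /\ forall m, good m w -> U m #<= F.
    have [Ww|] := pselect (W w); last by exists set0.
    (* Descend to the least [n] for which [w] is bad: a family witnessing goodness for its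
       predecessor serves every [m] for which [w] is good. If this [n] is 0, there is no such [m]
       and [set0] will do. *)
    have [_ [n]] := Wbad _ Ww; elim: n => [|n IH] ngood.
      exists set0 => _; split; first by split=> //; split.
      by move=> m /(goodW 0%N) g; case: ngood; exact: g.
    have [[V cV UV]|/IH//] := pselect (good n w).
    exists V => _; split=> // m gm; apply: card_le_trans UV; apply: Umono.
    rewrite leqNgt; apply/negP => nm.
    by apply: ngood; exact: goodW gm.
  exists (\bigcup_(w in W) F w).
    apply: (cellular_bigcup (w := id)) => [v w Wv Ww|w Ww]; first exact: dW.
    by have [] := HF w Ww.
  move=> n; have [w Ww gw] := Wgood n; have [_ /(_ _ gw) UF] := HF w Ww.
  by apply: card_le_trans UF _; apply: subset_card_le => u; exists w.
move=> /forall2NP Wm.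
have wm w : W w -> ~ good m w by move=> Ww; case: (Wm w).
have iUm : infinite_set (U m).
  apply/infiniteP; apply: card_le_trans (Umono _ _ (leq0n m)).
  exact/infiniteP.
(* [u] in [U n] is determined by a member [w] of [W] that it meets and by its
   trace on [w]; there are fewer such traces than members of [U m]. *)
have Un n : U n #<= W `*` U m.
  have /choice[f Hf] w : exists f : set T -> set T, W w ->
      let A := [set v | exists2 u, U n u & v = u `&` w /\ v !=set0] in
      set_fun A (U m) f /\ set_inj A f.
    have [Ww|] := pselect (W w); last by exists id.
    set A := [set v | _].
    suff [f fA finj] : exists2 f : set T -> set T, set_fun A (U m) f & set_inj A f.
      by exists f.
    apply: card_leE; last exact: infinite_setN0.
    (* The traces form a cellular family in [w]; were they at least as many as [U m], [w] would be
       good for [m]. *)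
    have [//|UA] := card_le_total A (U m); exfalso; apply: (wm w Ww).
    exists A => //; have [[oU dU] _] := cU n; split.
      split=> [_ [u Uu [-> _]]|_ _ [u Uu [-> uw0]] [v Uv [-> vw0]] uv].
        by apply: openI; [exact: oU|exact: oW].
      have uv' : u <> v by move=> e; apply: uv; rewrite e.
      by rewrite setIACA (dU _ _ Uu Uv uv') set0I.
    by move=> _ [u Uu [-> uw0]]; split=> // x [].
  have [[oU dU] U0] := cU n.
  apply: (@card_le_rel _ _ _ _
    (fun u p => [/\ W p.1, (u `&` p.1) !=set0 & p.2 = f p.1 (u `&` p.1)])).
    move=> u Uu; have [u0 _] := U0 _ Uu.
    have [w Ww uw] := Wdense _ (oU _ Uu) u0.
    exists (w, f w (u `&` w)) => //; split=> //=.
    by have [fA _] := Hf w Ww; apply: fA; exists u.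
  move=> u v [w z] Uu Uv [/= Ww uw ->] [_ vw] /=.
  have [_ finj] := Hf w Ww => /finj; rewrite !inE => e.
  have {}e : u `&` w = v `&` w by apply: e; [exists u|exists v].
  apply: contrapT => /(dU _ _ Uu Uv) uv0.
  have [x [ux wx]] := uw; have [vx _] : (v `&` w) x by rewrite -e.
  by have : (u `&` v) x by []; rewrite uv0.
(* The product is bounded by its larger factor, and both factors are cellular. *)
have [WUm|UmW] := card_le_total W (U m).
  exists (U m) => [|n]; first by have [] := cU m.
  apply: card_le_trans (Un n) _; apply: card_le_trans (card_le_setX_idem iUm).
  by apply: card_le_setX => //; exact: card_lexx.
have iW : infinite_set W.
  by apply/infiniteP; apply: card_le_trans UmW; exact/infiniteP.
exists W => // n.
apply: card_le_trans (Un n) _; apply: card_le_trans (card_le_setX_idem iW).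
by apply: card_le_setX => //; exact: card_lexx.
Qed.

(** Repeatedly split an infinite open set into a nonempty open piece and an infinite open remainder.
    Two of its points are separated by open [A] and [B]: if [A] cuts out a finite, hence closed,
    set, that is the piece; otherwise [B] cuts out the piece and [A] the remainder. *)
Lemma infinite_cellular_family {T : topologicalType} :
  hausdorff_space T -> infinite_set [set: T] ->
  exists2 V : set (set T), cellular_in [set: T] V & infinite_set V.
Proof.
move=> hT iT.
pose S := {G : set T | open G /\ infinite_set G}.
have cl1 := hausdorff_accessible hT.
have clF (A : set T) : finite_set A -> closed A.
  by move: A; apply/accessible_finite_set_closed.
have step (G : S) : exists p : set T * S,
    [/\ open p.1, p.1 !=set0, p.1 `<=` sval G, sval p.2 `<=` sval G &
        p.1 `&` sval p.2 = set0].
  case: G => G [oG iG] /=.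
  have [f fG finj] := infinite_set_nat_inj iG.
  have /eqP f01 : f 0%N <> f 1%N by move/finj.
  have := hT; rewrite open_hausdorff => /(_ _ _ f01)[[A B] /= [A0 B1] [oA oB AB]].
  rewrite !inE in A0 B1.
  have oAG : open (A `&` G) by exact: openI.
  have [fin|inf] := pselect (finite_set (A `&` G)).
    have iGA : open (G `\` (A `&` G)) /\ infinite_set (G `\` (A `&` G)).
      split; last exact: infinite_setD.
      by rewrite setDE; apply: openI => //; apply: closed_openC; exact: clF.
    pose H : S := exist _ (G `\` (A `&` G)) iGA.
    exists (A `&` G, H); split=> /=.
    - by [].
    - by exists (f 0%N).
    - by move=> x [].
    - by move=> x [].
    - by rewrite -subset0 => x [AGx [_ nAGx]]; exact: nAGx.
  pose H : S := exist _ (A `&` G) (conj oAG inf).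
  exists (B `&` G, H); split=> /=.
  - exact: openI.
  - by exists (f 1%N).
  - by move=> x [].
  - by move=> x [].
  - by rewrite setIACA (setIC B) (eqP AB) set0I.
have [stp Hstp] := choice step.
have iTT : open [set: T] /\ infinite_set [set: T] by split=> //; exact: openT.
pose G n : S := iter n (fun G => (stp G).2) (exist _ setT iTT).
pose u n := (stp (G n)).1.
have Gmono m n : (m <= n)%N -> sval (G n) `<=` sval (G m).
  elim: n => [|n IH]; first by rewrite leqn0 => /eqP ->.
  rewrite leq_eqVlt => /orP[/eqP ->//|/IH]; apply: subset_trans.
  by have [] := Hstp (G n).
have udisj m n : (m < n)%N -> u m `&` u n = set0.
  move=> mn; have [_ _ _ _ d] := Hstp (G m); rewrite -subset0 -d => x [umx unx].
  split=> //; apply: (Gmono _ _ mn).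
  by have [_ _ uG _ _] := Hstp (G n); exact: uG.
have u0 n : u n !=set0 by have [] := Hstp (G n).
have udisj' m n : m <> n -> u m `&` u n = set0.
  by move=> /eqP; rewrite neq_ltn => /orP[/udisj//|/udisj]; rewrite setIC.
have uinj : injective u.
  move=> m n e; apply: contrapT => /udisj'; rewrite e setIid => E.
  by have := u0 n; rewrite E => -[].
exists (range u).
  split; last by move=> _ [n _ <-].
  split; first by move=> _ [n _ <-]; have [] := Hstp (G n).
  by move=> _ _ [m _ <-] [n _ <-] mn; apply: udisj' => e; apply: mn; rewrite e.
apply/infiniteP; apply: (@card_le_rel _ _ _ _ (fun n v => v = u n)) => [n _|m n v _ _ ->].
  by exists (u n).
exact: uinj.
Qed.

Local Open Scope ring_scope.
Local Open Scope card_scope.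

(** * Compactness and Namioka uniformity *)

(** One direction uses the filter of sets with finitely covered complement, the other the open sets
    disjoint from members of a filter without cluster point. *)
Lemma compact_coverP (T : topologicalType) : compact [set: T] <->
  forall (I : choiceType) (W : I -> set T), (forall i, open (W i)) ->
    (forall t, exists i, W i t) ->
    exists s : seq I, forall t, exists2 i, i \in s & W i t.
Proof.
split=> [cT I W oW covW|cov F PF _].
  apply: contrapT => /forallNP nos.
  pose F : set_system T :=
    [set A | exists s : seq I, forall t, A t \/ exists2 i, i \in s & W i t].
  have PF : ProperFilter F.
    apply: Build_ProperFilter_ex.
      move=> A [s As]; apply: contrapT => A0; apply: (nos s) => t.
      by have [At|//] := As t; case: A0; exists t.
    split; first by exists [::] => t; left.
    - move=> A B [s As] [s' Bs]; exists (s ++ s') => t.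
      have [At|[i si Wi]] := As t; last first.
        by right; exists i => //; rewrite mem_cat si.
      have [Bt|[i si Wi]] := Bs t; last first.
        by right; exists i => //; rewrite mem_cat si orbT.
      by left.
    - move=> A B AB [s As]; exists s => t.
      by have [At|?] := As t; [left; exact: AB|right].
  have [p [_ clp]] := cT F PF filterT; have [i Wip] := covW p.
  have [||q [nWq Wq]//] := clp (~` W i) (W i).
    exists [:: i] => t; have [Wt|nWt] := pselect (W i t); last by left.
    by right; exists i => //; rewrite mem_head.
  by apply: open_nbhs_nbhs; split.
apply: contrapT => /forallNP ncl.
have /choice[N HN] t : exists N : set T * set T,
    [/\ open N.1, N.1 t, F N.2 & N.1 `&` N.2 = set0].
  have := ncl t; rewrite not_andP => -[/(_ Logic.I)//|/existsNP[A /existsNP[B]]].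
  move=> /not_implyP[FA /not_implyP[Bt AB]].
  have AB0 : A `&` B = set0 by apply/eqP; apply: contrapT => /negP/set0P.
  exists (B°, A); split=> //=; first exact: open_interior.
  by rewrite -subset0 -AB0 => x [/interior_subset Bx Ax].
have [t|t|s Hs] := cov T (fun t => (N t).1).
- by have [] := HN t.
- by exists t; have [] := HN t.
suff : F set0 by apply/filter_not_empty.
have : F [set x | forall t, t \in s -> (N t).2 x].
  elim: s {Hs} => [|t s IH]; first by apply: filterS filterT.
  have [_ _ FNt _] := HN t.
  apply: filterS (filterI IH FNt) => x [IHx Nx] u.
  by rewrite in_cons => /orP[/eqP ->//|]; exact: IHx.
apply: filterS => x Nx; have [t ts Ntx] := Hs x; have [_ _ _ <-] := HN t.
by split=> //; exact: Nx.
Qed.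

Lemma ultra_fmap {T U : Type} (f : T -> U) (F : set_system T) :
  UltraFilter F -> UltraFilter (f @ F).
Proof.
move=> UF; split; first exact: fmap_proper_filter.
move=> G PG FG; apply/seteqP; split=> [A GA|]; last exact: FG.
have [//|FnA] := in_ultra_setVsetC (f @^-1` A) UF.
have GnA : G (~` A) by exact: FG.
by have [x []] := @filter_ex _ _ PG _ (filterI GA GnA).
Qed.

Lemma mcont_near {R : realType} {T : topologicalType} {Z : Type}
  {I : Type} (d : Z -> Z -> R) (f : T -> Z) (x : I -> T) (F : set_system I) (p : T) :
  mcont d f -> x @ F --> p ->
  forall e, 0 < e -> F [set i | d (f p) (f (x i)) < e].
Proof. by move=> cf xp e e0; exact: (xp _ (cf p e e0)). Qed.

Section namioka.
Variables (R : realType) (X C : topologicalType) (Z : Type) (d : Z -> Z -> R).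
Variable e : X -> C -> Z.
Hypothesis dm : is_metric d.
Hypothesis cX : compact [set: X].
Hypothesis cC : compact [set: C].
Hypothesis eC : forall x, mcont d (e x).
Hypothesis eX : forall c, mcont d (fun x => e x c).

Let d0 x : d x x = 0. Proof. by have [+ _] := dm; apply. Qed.
Let dsep x y : d x y = 0 -> x = y. Proof. by have [_ [+ _]] := dm; apply. Qed.
Let dC x y : d x y = d y x. Proof. by have [_ [_ [+ _]]] := dm; apply. Qed.
Let dT y x z : d x z <= d x y + d y z. Proof. by have [_ [_ [_ +]]] := dm; apply. Qed.
Let d_ge0 x y : 0 <= d x y.
Proof. have := dT y x x; rewrite d0 (dC y x) => h. lra. Qed.

Let uniform_on (e0 : R) (u : set X) :=
  forall x y c, u x -> u y -> d (e x c) (e y c) <= e0.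

Let stable (e0 : R) (u : set X) :=
  forall v, open v -> v !=set0 -> v `<=` u -> ~ uniform_on e0 v.

(* Otherwise, c would be controlled on [u] by its values at [L], hence by
   finitely many c_j up to e0 / 3, and a neighbourhood on which the e(., c_j)
   oscillate by e0 / 3 would be uniform. *)
Let stable_step (e0 : R) (u : set X) (L : seq X) (r : R) :
  0 < e0 -> 0 < r -> open u -> u !=set0 -> stable e0 u ->
  exists x c c', [/\ u x, forall a, a \in L -> d (e a c) (e a c') < r &
    e0 / 3 < d (e x c) (e x c')].
Proof.
move=> e0_gt0 r_gt0 ou [x0 ux0] su; apply: contrapT => no.
have close x c c' : u x -> (forall a, a \in L -> d (e a c) (e a c') < r) ->
    d (e x c) (e x c') <= e0 / 3.
  by move=> ux cc'; rewrite leNgt; apply/negP => h; apply: no; exists x, c, c'.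
pose N c := [set c' | forall a, a \in L -> d (e a c) (e a c') < r].
have nN c : nbhs c (N c).
  rewrite /N; elim: L {no close N} => [|a L IH]; first exact: filterS filterT.
  apply: filterS (filterI IH (eC a c r_gt0)) => c' [Hc' Ha] b.
  by rewrite in_cons => /orP[/eqP ->//|]; exact: Hc'.
have [i|c|s Hs] := (compact_coverP C).1 cC C (fun c => (N c)°).
- exact: open_interior.
- by exists c; exact: nN.
pose v := (u `&` [set x | forall c, c \in s -> d (e x0 c) (e x c) < e0 / 6])°.
(* Two moves between [c] and [c'] cost [e0 / 3] each, two moves through [x0] cost [e0 / 6] each:
   [e0] in all. *)
have e6 : 0 < e0 / 6 by lra.
have vx0 : v x0.
  apply: filterI; first by apply: open_nbhs_nbhs; split.
  elim: s {Hs v} => [|c s IH]; first exact: filterS filterT.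
  apply: filterS (filterI IH (eX c x0 e6)) => y [Hy Hc] b.
  by rewrite in_cons => /orP[/eqP ->//|]; exact: Hy.
apply: (su v) => [||y /interior_subset[]//|]; first exact: open_interior.
  by exists x0.
move=> x y c /interior_subset[ux Hx] /interior_subset[uy Hy].
have [c' c's /interior_subset Nc'c] := Hs c.
have := close x _ _ ux Nc'c; have := close y _ _ uy Nc'c.
have := Hx _ c's; have := Hy _ c's.
have := dT (e x c') (e x c) (e y c); have := dT (e y c') (e x c') (e y c).
have := dT (e x0 c') (e x c') (e y c').
rewrite (dC (e x c) (e x c')) (dC (e x c') (e x0 c')); lra.
Qed.

(* If the conclusion fails, [stable_step] produces x_n, c_n, c'_n such that
   e(x_m, c_n) is close to e(x_m, c'_n) for m < n and far from it for m > n.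
   Limits along an ultrafilter contradict the separate continuity of e. *)
Lemma namioka_uniform_open (e0 : R) (G : set X) : 0 < e0 -> open G -> G !=set0 ->
  exists u, [/\ open u, u !=set0, u `<=` G &
    forall x y c, u x -> u y -> d (e x c) (e y c) <= e0].
Proof.
move=> e0_gt0 oG G0; apply: contrapT => no.
have sG : stable e0 G.
  by move=> v ov v0 vG vu; apply: no; exists v.
pose good (p : seq X * set X) := [/\ open p.2, p.2 !=set0 & p.2 `<=` G].
pose S := {p | good p}.
(* A state lists the points chosen so far, on which [c] and [c'] must be close, and an open set for
   the later points, shrunk so that [c] and [c'] stay far apart on it. The list length is the step
   number [n], whence the tolerance [1 / (n + 1)]. *)
pose next (p q : S) (c c' : C) := exists x, [/\ (sval p).2 x,
  (sval q).1 = x :: (sval p).1,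
  (sval q).2 = (sval p).2 `&` [set y | e0 / 3 < d (e y c) (e y c')] &
  forall a, a \in (sval p).1 -> d (e a c) (e a c') < (size (sval p).1).+1%:R^-1].
have /choice[stp Hstp] (p : S) : exists q : S * (C * C), next p q.1 q.2.1 q.2.2.
  case: p => -[L u] /= gp; have [/= ou u0 uG] := gp.
  have su : stable e0 u.
    by move=> v ov v0 vu; apply: sG => //; exact: subset_trans uG.
  have r0 : 0 < (size L).+1%:R^-1 :> R by rewrite invr_gt0.
  have [x [c [c' [ux Hr He]]]] := stable_step L e0_gt0 r0 ou u0 su.
  have gq : good (x :: L, u `&` [set y | e0 / 3 < d (e y c) (e y c')]).
    split=> /=; last by move=> y [/uG].
      rewrite openE => y [uy Hy].
      have h0 : 0 < (d (e y c) (e y c') - e0 / 3) / 2 by move: Hy => /=; lra.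
      apply: filterI; first by apply: open_nbhs_nbhs; split.
      apply: filterS (filterI (eX c y h0) (eX c' y h0)) => z [] /=.
      have := dT (e z c) (e y c) (e y c'); have := dT (e z c') (e z c) (e y c').
      by rewrite (dC (e z c') (e y c')); lra.
    by exists x.
  by exists (exist _ _ gq, (c, c')), x.
have gG : good ([::], G) by split.
pose st n : S := iter n (fun p => (stp p).1) (exist _ _ gG).
pose c n := (stp (st n)).2.1; pose c' n := (stp (st n)).2.2.
have /choice[x Hx] n : exists x, [/\ (sval (st n)).2 x,
  (sval (st n.+1)).1 = x :: (sval (st n)).1,
  (sval (st n.+1)).2 = (sval (st n)).2 `&` [set y | e0 / 3 < d (e y (c n)) (e y (c' n))] &
  forall a, a \in (sval (st n)).1 -> d (e a (c n)) (e a (c' n)) < n.+1%:R^-1].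
  have szn : size (sval (st n)).1 = n.
    elim: n => //= n IH; have [x [_ -> _ _]] := Hstp (st n).
    by rewrite /= IH.
  by have [x [? ? ? H]] := Hstp (st n); exists x; split=> //; move: H; rewrite szn.
have xfar n m : (n < m)%N -> e0 / 3 < d (e (x m) (c n)) (e (x m) (c' n)).
  move=> nm; have [+ _ _ _] := Hx m.
  suff H : (sval (st m)).2 `<=` (sval (st n.+1)).2.
    by move=> /H; have [_ _ -> _] := Hx n; case.
  elim: m nm => // m IH; rewrite ltnS leq_eqVlt => /orP[/eqP ->//|/IH].
  by apply: subset_trans; have [_ _ -> _] := Hx m => y [].
have xnear n m : (m < n)%N -> d (e (x m) (c n)) (e (x m) (c' n)) < n.+1%:R^-1.
  move=> mn; have [_ _ _ +] := Hx n; apply.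
  elim: n mn => // n IH; rewrite ltnS; have [_ -> _ _] := Hx n.
  by rewrite leq_eqVlt => /orP[/eqP ->|/IH mx]; rewrite in_cons ?eqxx// mx orbT.
(* A single ultrafilter makes [x], [c] and [c'] converge simultaneously. *)
have [F [UF ooF]] := ultraFilterLemma (eventually_filter : ProperFilter \oo).
have PF : ProperFilter F by exact: ultra_proper.
have lim (T : topologicalType) (z : nat -> T) : compact [set: T] ->
    exists p : T, z @ F --> p.
  rewrite compact_ultra => /(_ (z @ F) (ultra_fmap z UF) filterT)[p [_ zp]].
  by exists p.
have [xo xoP] := lim _ x cX; have [co coP] := lim _ c cC.
have [c'o c'oP] := lim _ c' cC.
(* With [x n] fixed, the tolerances tend to 0 along the indices of [c] and [c']; the limit in [n]
   then gives equality at [xo]. *)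
have e_eq n : e (x n) co = e (x n) c'o.
  apply: dsep; apply/eqP; rewrite eq_le d_ge0 andbT; apply/ler_addgt0Pr => r r0.
  rewrite add0r.
  have r3 : 0 < r / 3 by lra.
  have nb : F [set m | d (e (x n) (c m)) (e (x n) (c' m)) < r / 3].
    apply: ooF; near=> m.
    have nm : (n < m)%N by near: m; exact: nbhs_infty_gt.
    apply: (lt_trans (xnear m n nm)).
    by near: m; exact: near_infty_natSinv_lt (PosNum r3).
  have [m [[]]] := filter_ex (filterI (filterI
    (mcont_near (eC (x n)) coP r3) (mcont_near (eC (x n)) c'oP r3)) nb).
  move=> /= h1 h2 h3.
  have := dT (e (x n) (c m)) (e (x n) co) (e (x n) c'o).
  have := dT (e (x n) (c' m)) (e (x n) (c m)) (e (x n) c'o).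
  by rewrite (dC (e (x n) (c' m))); lra.
have exo_eq : e xo co = e xo c'o.
  apply: dsep; apply/eqP; rewrite eq_le d_ge0 andbT; apply/ler_addgt0Pr => r r0.
  rewrite add0r.
  have r2 : 0 < r / 2 by lra.
  have [m []] := filter_ex (filterI
    (mcont_near (eX co) xoP r2) (mcont_near (eX c'o) xoP r2)).
  rewrite /= e_eq => h1 h2.
  have := dT (e (x m) c'o) (e xo co) (e xo c'o).
  by rewrite (dC (e (x m) c'o)); lra.
(* With [c n] and [c' n] fixed, the limit along the points [x m], [m > n], keeps the distance
   [e0 / 3]. *)
have far n : e0 / 3 <= d (e xo (c n)) (e xo (c' n)).
  apply/ler_addgt0Pr => r r0.
  have r2 : 0 < r / 2 by lra.
  have nb : F [set m | (n < m)%N] by apply: ooF; exact: nbhs_infty_gt.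
  have [m [[]]] := filter_ex (filterI (filterI
    (mcont_near (eX (c n)) xoP r2) (mcont_near (eX (c' n)) xoP r2)) nb).
  move=> /= h1 h2 /xfar h3.
  have := dT (e xo (c n)) (e (x m) (c n)) (e (x m) (c' n)).
  have := dT (e xo (c' n)) (e xo (c n)) (e (x m) (c' n)).
  by rewrite (dC (e (x m) (c n)) (e xo (c n))); lra.
(* Both values at [xo] come within [e0 / 6] of the common limit, against [far]. *)
have r6 : 0 < e0 / 6 by lra.
have [m []] := filter_ex (filterI
  (mcont_near (eC xo) coP r6) (mcont_near (eC xo) c'oP r6)).
rewrite /= exo_eq => h1 h2; have h3 := far m.
have := dT (e xo c'o) (e xo (c m)) (e xo (c' m)).
by rewrite (dC (e xo (c m)) (e xo c'o)); lra.
Unshelve. all: by end_near.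
Qed.

End namioka.

(** * A base bounded by a cellular family *)

Lemma card_le_bigcup {T U : Type} (F : nat -> set T) (B : set U) :
  infinite_set B -> (forall n, F n #<= B) -> \bigcup_n F n #<= B.
Proof.
move=> iB FB; apply: card_le_trans (card_le_setX_idem iB).
have [c cB cinj] := infinite_set_nat_inj iB.
have /choice[f Hf] n : exists f : T -> U, set_fun (F n) B f /\ set_inj (F n) f.
  by have [f] := card_leE (FB n) (infinite_setN0 iB); exists f.
apply: (@card_le_rel _ _ _ _ (fun t p => exists2 n, F n t & p = (c n, f n t))).
  move=> t [n _ Fnt]; exists (c n, f n t); last by exists n.
  by split; [exact: cB|have [fB _] := Hf n; exact: fB].
move=> s t p _ _ [n Fs ->] [m Ft [/cinj nm]]; rewrite -{}nm in Ft *.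
by have [_ finj] := Hf n; apply: finj; rewrite inE.
Qed.

(** To obtain a nondecreasing sequence with infinite first term, [U] starts from an infinite
    cellular family and passes to [F m] whenever that is larger. *)
Lemma cellular_upper_bound_hausdorff {T : topologicalType}
  (F : nat -> set (set T)) :
  hausdorff_space T -> infinite_set [set: T] ->
  (forall n, cellular_in setT (F n)) ->
  exists V : set (set T), [/\ cellular_family V, infinite_set V &
    forall n, F n #<= V].
Proof.
move=> hT iT cF; have [V0 cV0 iV0] := infinite_cellular_family hT iT.
pose U := fix U n := if n is m.+1 then
  if F m #<= U m then U m else F m else V0.
have cU n : cellular_in setT (U n) by elim: n => //= n IH; case: ifP.
have [n||V cV UV] := cellular_upper_bound cU.
- rewrite /=; case: ifPn => [_|/negbTE h]; first exact: card_lexx.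
  by have [//|Fn] := card_le_total (U n) (F n); rewrite Fn in h.
- exact: iV0.
exists V; split=> // [|n].
  by apply/infiniteP; apply: card_le_trans (UV 0%N); exact/infiniteP.
apply: card_le_trans (UV n.+1); rewrite /=; case: ifP => // _.
Qed.

(** [T] and [e] are abstract so that the result can be applied again with [X] and [Y] exchanged. *)
Lemma base_le_cellular (R : realType) (T X Y : topologicalType) (Z : Type)
  (d : Z -> Z -> R) (e : T -> X -> Y -> Z) :
  is_metric d ->
  hausdorff_space X -> compact [set: X] -> infinite_set [set: X] ->
  compact [set: Y] -> compact [set: T] ->
  (forall x s (r : R), 0 < r ->
     \forall t \near s, forall y, d (e s x y) (e t x y) < r) ->
  (forall s x, mcont d (e s x)) ->
  (forall s y, mcont d (fun x => e s x y)) ->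
  (forall s t, (forall x y, e s x y = e t x y) -> s = t) ->
  exists (B : set (set T)) (V : set (set X)),
    [/\ forall b, B b -> open b,
        forall W s, open W -> W s -> exists2 b, B b & b s /\ b `<=` W,
        cellular_family V & B #<= V].
Proof.
move=> dm hX cX iX cY cT eT eY eX esep.
have dsep x y : d x y = 0 -> x = y by have [_ [+ _]] := dm; apply.
have dC x y : d x y = d y x by have [_ [_ [+ _]]] := dm; apply.
have dT y x z : d x z <= d x y + d y z by have [_ [_ [_ +]]] := dm; apply.
have d_ge0 x y : 0 <= d x y.
  by have := dT y x x; have [-> _] := dm; rewrite (dC y x); lra.
(* An empty [T] has the empty base; otherwise [t0] serves as the default of [nth]. *)
have [[t0 _]|noT] := pselect (exists t : T, True); last first.
  exists set0, set0; split=> //.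
  by move=> W s; case: noT; exists s.
have cTY : compact [set: T * Y] by rewrite -setXTT; exact: compact_setX.
have [rad rad_gt0 rad_small] : exists2 rad : nat -> R, forall n, 0 < rad n &
    forall r, 0 < r -> exists n, rad n < r.
  exists (fun n => n.+1%:R^-1) => [n|r r0]; first by rewrite invr_gt0.
  by have [n _ /(_ n (leqnn n))] := near_infty_natSinv_lt (PosNum r0); exists n.
pose osc n (u : set X) := forall x y (c : T * Y), u x -> u y ->
  d (e c.1 x c.2) (e c.1 y c.2) <= rad n.
have /choice[F HF] n : exists F : set (set X), [/\ cellular_family F,
    forall w, F w -> w !=set0 /\ osc n w &
    forall G, open G -> G !=set0 -> exists2 w, F w & (G `&` w) !=set0].
  apply: max_cellular_family => G oG G0.
  apply: (@namioka_uniform_open R X (T * Y)%type Z d (fun x c => e c.1 x c.2)) => //.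
  (* Joint continuity: [r / 2] for changing [s], uniformly in the point of [Y], and [r / 2] for
     changing [y]. *)
  move=> x [s y] r r0; have r2 : 0 < r / 2 by lra.
    exists ([set t | forall z, d (e s x z) (e t x z) < r / 2],
            [set z | d (e s x y) (e s x z) < r / 2]).
      by split; [exact: eT|exact: eY].
    move=> [t z] [/= /(_ z) h1 h2].
    by have := dT (e s x z) (e s x y) (e t x z); lra.
have [V [cV iV FV]] : exists V : set (set X), [/\ cellular_family V,
    infinite_set V & forall n, F n #<= V].
  apply: cellular_upper_bound_hausdorff => // n; have [cF F0 _] := HF n.
  by split=> // v /F0[].
have [x0 _] := infinite_setN0 iX.
have /choice[pt Hpt] (u : set X) : exists x, u !=set0 -> u x.
  by have [[x ux]|nu] := pselect (u !=set0); [exists x|exists x0].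
pose ball a n s := [set t | forall y, d (e s a y) (e t a y) < rad n]°.
have /choice[S HS] (p : X * nat) : exists S : seq T,
    forall t, exists2 s, s \in S & ball p.1 p.2 s t.
  apply: ((compact_coverP T).1 cT T (ball p.1 p.2)) => [s|t].
    exact: open_interior.
  by exists t; apply: eT; exact: rad_gt0.
(* The index [(u, (n, k))] stands for the [k]-th ball of a finite cover of [T]. Numbering the
   centres by [k] keeps the indices countable over each [u]. *)
pose g (p : set X * (nat * nat)) :=
  ball (pt p.1) p.2.1 (nth t0 (S (pt p.1, p.2.1)) p.2.2).
pose A := (\bigcup_n F n) `*` [set: nat * nat].
pose inter (L : seq (set X * (nat * nat))) := [set t | forall p, p \in L -> g p t].
have oI L : open (inter L).
  elim: L => [|p L IH].
    suff -> : inter [::] = setT by exact: openT.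
    by apply/seteqP.
  suff -> : inter (p :: L) = g p `&` inter L by apply: openI => //; exact: open_interior.
  apply/seteqP; split=> [t It|t [gt It] q].
    split; first by apply: It; rewrite mem_head.
    by move=> q qL; apply: It; rewrite in_cons qL orbT.
  by rewrite in_cons => /orP[/eqP ->//|]; exact: It.
have separate s t : s <> t ->
    exists p q, [/\ A p, g p s, g q t & g p `&` g q = set0].
  move=> st; have [x [y exy]] : exists x y, e s x y <> e t x y.
    apply: contrapT => no; apply: st; apply: esep => x y.
    by apply: contrapT => exy; apply: no; exists x, y.
  pose r := d (e s x y) (e t x y).
  have r0 : 0 < r by rewrite lt_neqAle d_ge0 andbT; apply/eqP => /esym/dsep.
  (* Passing from [x'] to [a] costs at most [2 * rad n], so the distance at [a] exceeds
     [r / 2 - r / 6 = r / 3 > 4 * rad n]. Two balls of radius [rad n] with a common point would give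
     less than [4 * rad n]. *)
  have r12 : 0 < r / 12 by lra.
  have [n nr] := rad_small _ r12.
  pose G := [set x' | r / 2 < d (e s x' y) (e t x' y)]°.
  have Gx : G x.
    have r4 : 0 < r / 4 by lra.
    apply: filterS (filterI (eX s y x _ r4) (eX t y x _ r4)) => x' [/= h1 h2].
    have := dT (e s x' y) (e s x y) (e t x y).
    have := dT (e t x' y) (e s x' y) (e t x y).
    by rewrite (dC (e t x' y) (e t x y)) -/r; lra.
  have [_ Fprop Fdense] := HF n.
  have [u Fu [x' [/interior_subset/= Gx' ux']]] :=
    Fdense G (open_interior _) (ex_intro _ x Gx).
  have [u0 uosc] := Fprop _ Fu.
  have upt := Hpt _ u0.
  pose a := pt u.
  have sep_a : 4 * rad n < d (e s a y) (e t a y).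
    have h1 := uosc _ _ (s, y) ux' upt; have h2 := uosc _ _ (t, y) ux' upt.
    rewrite /= -/a in h1 h2.
    have := dT (e s a y) (e s x' y) (e t x' y).
    have := dT (e t a y) (e s a y) (e t x' y).
    by rewrite (dC (e t a y) (e t x' y)); lra.
  have [s' s'S bs] := HS (a, n) s; have [t' t'S bt] := HS (a, n) t.
  exists (u, (n, index s' (S (a, n)))), (u, (n, index t' (S (a, n)))).
  rewrite /g /= -/a !nth_index//; split=> //; first by split=> //; exists n.
  rewrite -subset0 => z [/interior_subset/(_ y) z1 /interior_subset/(_ y) z2].
  have /= /(_ y) s1 := interior_subset bs; have /= /(_ y) t1 := interior_subset bt.
  have := dT (e s' a y) (e s a y) (e t a y).
  have := dT (e z a y) (e s' a y) (e t a y).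
  have := dT (e t' a y) (e z a y) (e t a y).
  by rewrite (dC (e s a y) (e s' a y)) (dC (e z a y) (e t' a y)); lra.
exists [set inter L | L in [set L | forall p, p \in L -> A p]], V.
split=> //; first by move=> _ [L _ <-].
  move=> W s oW Ws.
  have /choice[pq Hpq] t : exists pq, ~ W t -> [/\ A pq.1, g pq.1 s, g pq.2 t &
      g pq.1 `&` g pq.2 = set0].
    have [Wt|nWt] := pselect (W t).
      by exists ((set0, (0%N, 0%N)), (set0, (0%N, 0%N))).
    have [p [q H]] : exists p q, [/\ A p, g p s, g q t & g p `&` g q = set0].
      by apply: separate => st; apply: nWt; rewrite -st.
    by exists (p, q).
  (* Cover [T] by [W] and, for [t] outside [W], by balls about [t] disjoint from balls about [s]. A
     finite subcover leaves finitely many of the latter, whose intersection lies in [W]. *)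
  pose N t := if `[< W t >] then W else g (pq t).2.
  have [t|t|ts Hts] := (compact_coverP T).1 cT T N.
  - by rewrite /N; case: asboolP => // _; exact: open_interior.
  - by exists t; rewrite /N; case: asboolP => // /Hpq[].
  pose L := [seq (pq t).1 | t <- ts & ~~ `[< W t >]].
  have inL p : p \in L -> exists2 t, ~ W t & p = (pq t).1.
    by move=> /mapP[t]; rewrite mem_filter => /andP[/asboolPn nWt _] ->; exists t.
  exists (inter L); first by exists L => // p /inL[t /Hpq[? _ _ _] ->].
  split; first by move=> p /inL[t /Hpq[_ ? _ _] ->].
  move=> z zL; have [t tts] := Hts z; rewrite /N; case: asboolP => // nWt gz.
  exfalso; have [_ _ _ d0] := Hpq _ nWt.
  suff : set0 z by []; rewrite -d0; split=> //; apply: zL.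
  by apply/mapP; exists t => //; rewrite mem_filter tts andbT; apply/asboolPn.
apply: (card_le_trans (card_image_le _ _)); apply: card_le_seq => //.
apply: card_le_trans (card_le_setX_idem iV); apply: card_le_setX.
  exact: card_le_bigcup.
apply: card_le_trans ((infiniteP V).1 iV).
by have := card_nat2; rewrite card_eq_le => /andP[].
Qed.

(** * The cross-uniform topology *)

Lemma dcross_lt {R : realType} {X Y Z : Type} (d : Z -> Z -> R)
  (c : X * Y) (s t : X * Y -> Z) (r : R) :
  (dcross d c s t < r%:E)%E -> forall p, cross c p -> d (s p) (t p) < r.
Proof.
move=> h p cp; rewrite -lte_fin; apply: le_lt_trans h.
by apply: ereal_sup_ubound; exists p.
Qed.

Lemma dcross_le {R : realType} {X Y Z : Type} (d : Z -> Z -> R)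
  (c : X * Y) (s t : X * Y -> Z) (r : R) :
  (forall p, cross c p -> d (s p) (t p) <= r) -> (dcross d c s t <= r%:E)%E.
Proof. by move=> h; apply: ge_ereal_sup => _ [p cp <-]; rewrite lee_fin h. Qed.

Definition cu_ball {R : realType} {X Y : topologicalType} {Z : Type}
  (d : Z -> Z -> R) (F : seq (X * Y)) (s : X * Y -> Z) (r : R) :=
  [set t | Ssep d t /\ forall c, c \in F -> (dcross d c s t < r%:E)%E].

Lemma cu_ball_center {R : realType} {X Y : topologicalType} {Z : Type}
  (d : Z -> Z -> R) (F : seq (X * Y)) (s : X * Y -> Z) (r : R) :
  is_metric d -> 0 < r -> Ssep d s -> cu_ball d F s r s.
Proof.
move=> [d0 _] r0 Ss; split=> // c _; apply: (@le_lt_trans _ _ 0%:E).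
  by apply: dcross_le => p _; rewrite d0.
by rewrite lte_fin.
Qed.

(** A supremum strictly below [r] leaves a positive margin; the least margin [r'] over the finite
    list is halved to keep the inequality strict. *)
Lemma cu_open_ball {R : realType} {X Y : topologicalType} {Z : Type}
  (d : Z -> Z -> R) (F : seq (X * Y)) (s : X * Y -> Z) (r : R) :
  is_metric d -> cu_open d (cu_ball d F s r).
Proof.
move=> [_ [_ [_ dT]]]; split=> [t []//|t [St tF]].
have [r' r'0 Hr'] : exists2 r' : R, 0 < r' &
    forall c, c \in F -> forall p, cross c p -> d (s p) (t p) <= r - r'.
  elim: F tF => [|c F IH] tF; first by exists 1.
  have [c' c'F|r1 r1_gt0 Hr1] := IH.
    by apply: tF; rewrite in_cons c'F orbT.
  have [r2 r2_gt0 Hr2] : exists2 r2 : R, 0 < r2 &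
      forall p, cross c p -> d (s p) (t p) <= r - r2.
    have := tF c (mem_head _ _); case E : (dcross d c s t) => [v| |] //.
    - rewrite lte_fin => vr; exists (r - v); first by rewrite subr_gt0.
      move=> p cp; rewrite opprB addrC subrK -lee_fin -E.
      by apply: ereal_sup_ubound; exists p.
    - exists 1 => // p cp; have : ((d (s p) (t p))%:E <= dcross d c s t)%E.
        by apply: ereal_sup_ubound; exists p.
      by rewrite E.
  exists (Num.min r1 r2); first by rewrite lt_min r1_gt0.
  move=> c'; rewrite in_cons => /orP[/eqP ->|c'F] p cp.
    by apply: le_trans (Hr2 _ cp) _; rewrite lerB// ge_min lexx orbT.
  by apply: le_trans (Hr1 _ c'F _ cp) _; rewrite lerB// ge_min lexx.
exists F, (r' / 2); split; first by lra.
move=> u [Su uF]; split=> // c cF; apply: (@le_lt_trans _ _ (r - r' / 2)%:E).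
  apply: dcross_le => p cp.
  have := dcross_lt (uF c cF) cp; have := Hr' c cF p cp.
  by have := dT (s p) (t p) (u p); lra.
by rewrite lte_fin; lra.
Qed.

(* The carrier of the subspace [K]; [d] is a phantom argument that selects the
   cross-uniform topology. *)
Definition cu_subspace {R : realType} {X Y : topologicalType} {Z : Type}
  (d : Z -> Z -> R) (K : set (X * Y -> Z)) : Type := {s : X * Y -> Z | K s}.

Section cu_subspace_topology.
Variables (R : realType) (X Y : topologicalType) (Z : Type) (d : Z -> Z -> R).
Variable K : set (X * Y -> Z).
Let T := cu_subspace d K.

(** The pseudometrics are restricted to [K]; [open_cu_trace] and [cu_extension] identify the result
    with the subspace topology. *)
Let op (A : set T) := forall s, A s -> exists (F : seq (X * Y)) (r : R), 0 < r /\
  forall t : T, (forall c, c \in F -> (dcross d c (sval s) (sval t) < r%:E)%E) -> A t.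

Let opT : op setT.
Proof. by move=> s _; exists [::], 1. Qed.

Let opI : setI_closed op.
Proof.
move=> A B oA oB s [/oA[F [r [r0 FA]]] /oB[G [q [q0 GB]]]].
exists (F ++ G), (Num.min r q); split; first by rewrite lt_min r0.
move=> t tFG; split; [apply: FA|apply: GB] => c cF;
    apply: (lt_le_trans (tFG c _)); rewrite ?mem_cat ?cF ?orbT//.
- by rewrite lee_fin ge_min lexx.
- by rewrite lee_fin ge_min lexx orbT.
Qed.

Let op_bigU (I : Type) (f : I -> set T) : (forall i, op (f i)) ->
  op (\bigcup_i f i).
Proof.
move=> of_ s [i _ /of_[F [r [r0 Ff]]]]; exists F, r; split=> // t /Ff.
by exists i.
Qed.

HB.instance Definition _ := gen_eqMixin (cu_subspace d K).
HB.instance Definition _ := gen_choiceMixin (cu_subspace d K).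
HB.instance Definition _ :=
  isOpenTopological.Build (cu_subspace d K) opT opI op_bigU.

Lemma cu_subspace_openE (A : set (cu_subspace d K)) : open A = op A.
Proof. by []. Qed.

End cu_subspace_topology.

Section cu_subspace_theory.
Variables (R : realType) (X Y : topologicalType) (Z : Type) (d : Z -> Z -> R).
Variable K : set (X * Y -> Z).
Hypothesis dm : is_metric d.
Hypothesis KS : K `<=` Ssep d.
Let T := cu_subspace d K.

Lemma open_cu_trace (W : set (X * Y -> Z)) :
  cu_open d W -> open [set s : T | W (sval s)].
Proof.
move=> [WS oW]; rewrite cu_subspace_openE => s /= /oW[F [r [r0 FW]]].
exists F, r; split=> // t tF; apply: FW; split=> //.
by apply: KS; exact: (svalP t).
Qed.

(** [W] is the union of the open sets whose trace on [K] lies in [A]; balls about points of [A] show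
    that it reaches all of [A]. *)
Lemma cu_extension (A : set T) : open A ->
  exists W, cu_open d W /\ forall s : T, A s <-> W (sval s).
Proof.
rewrite cu_subspace_openE => oA.
exists [set t | exists U, [/\ cu_open d U, U t & forall s : T, U (sval s) -> A s]].
split=> [|s].
  split=> [t [U [[US _] Ut _]]|t [U [oU Ut UA]]]; first exact: US.
  have [_ /(_ t Ut)[F [r [r0 FU]]]] := oU.
  by exists F, r; split=> // u /FU Uu; exists U.
split=> [As|[U [_ Us UA]]]; last exact: UA.
have [F [r [r0 FA]]] := oA s As.
exists (cu_ball d F (sval s) r); split; first exact: cu_open_ball.
  by apply: cu_ball_center => //; apply: KS; exact: (svalP s).
by move=> t [_ /FA].
Qed.

Lemma compact_cu_subspace : cu_compact d K -> compact [set: T].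
Proof.
move=> [_ cK]; apply/compact_coverP => I W oW covW.
have /choice[U HU] i := cu_extension (oW i).
have [|s Ks|F finF KF] := cK I U.
- by move=> i; have [] := HU i.
- have [i Wi] := covW (exist _ s Ks); exists i => //.
  by have [_ /(_ (exist _ s Ks))[+ _]] := HU i; exact.
- have [l lF] := (finite_seqP F).1 finF; exists l => s.
  have [i Fi Ui] := KF _ (svalP s); exists i; first by rewrite lF in Fi.
  by have [_ /(_ s)[_ +]] := HU i; exact.
Qed.

Lemma near_dcross (c : X * Y) (s : T) (r : R) : 0 < r ->
  \forall t \near s, forall p, cross c p -> d (sval s p) (sval t p) < r.
Proof.
move=> r0; have Ss : Ssep d (sval s) by apply: KS; exact: (svalP s).
apply: filterS (open_nbhs_nbhs (conj
    (open_cu_trace (cu_open_ball [:: c] (sval s) r dm))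
    (cu_ball_center [:: c] dm r0 Ss))).
by move=> t [_ /(_ c (mem_head _ _)) h] p; exact: dcross_lt.
Qed.

End cu_subspace_theory.

(* One base for both factors *)
Local Close Scope ring_scope.

(* w(K) < min(c#(X), c#(Y)): since c#(T) = sup{|U|^+ : U cellular},
   w(K) < c#(T) iff w(K) <= |U| for some cellular family U, i.e. iff some base
   B of K satisfies |B| <= |U|.  A single (e.g. minimal) base serves both. *)
Theorem theorem6p2 (R : realType) (X Y : topologicalType) (Z : Type)
  (d : Z -> Z -> R) (K : set (X * Y -> Z)) :
  hausdorff_space X -> compact [set: X] -> infinite_set [set: X] ->
  hausdorff_space Y -> compact [set: Y] -> infinite_set [set: Y] ->
  is_metric d ->
  cu_compact d K ->
  exists B : set (set (X * Y -> Z)), cu_base_of d K B /\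
    (exists UX : set (set X), cellular_family UX /\ B #<= UX) /\
    (exists UY : set (set Y), cellular_family UY /\ B #<= UY).
Proof.
move=> hX cX iX hY cY iY dm cK; have [KS _] := cK.
have [x0 _] := infinite_setN0 iX; have [y0 _] := infinite_setN0 iY.
pose T := cu_subspace d K.
have cT : compact [set: T] by exact: compact_cu_subspace.
have TS (s : T) : sepcont d (sval s) by apply: KS; exact: (svalP s).
have Tinj (s t : T) : (forall x y, sval s (x, y) = sval t (x, y)) -> s = t.
  case: s t => [s Ks] [t Kt] /= st; apply: eq_exist; apply/funext => -[x y].
  exact: st.
have [BX [VX [oBX bBX cVX BVX]]] :
    exists (B : set (set T)) (V : set (set X)),
    [/\ forall b, B b -> open b,
        forall W s, open W -> W s -> exists2 b, B b & b s /\ b `<=` W,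
        cellular_family V & B #<= V].
  apply: (@base_le_cellular R T X Y Z d (fun s x y => sval s (x, y))) => //.
  (* The cross of [(x, y0)] contains all points [(x, y)], so closeness on it is uniform in [y]. *)
  - move=> x s r r0; apply: filterS (near_dcross dm KS (x, y0) s r0) => t h y.
    by apply: h; left.
  - by move=> s x; have [+ _] := TS s; exact.
  - by move=> s y; have [_ +] := TS s; exact.
have [BY [VY [oBY bBY cVY BVY]]] :
    exists (B : set (set T)) (V : set (set Y)),
    [/\ forall b, B b -> open b,
        forall W s, open W -> W s -> exists2 b, B b & b s /\ b `<=` W,
        cellular_family V & B #<= V].
  apply: (@base_le_cellular R T Y X Z d (fun s y x => sval s (x, y))) => //.
  - move=> y s r r0; apply: filterS (near_dcross dm KS (x0, y) s r0) => t h x.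
    by apply: h; right.
  - by move=> s y; have [_ +] := TS s; exact.
  - by move=> s x; have [+ _] := TS s; exact.
  - by move=> s t st; apply: Tinj.
have [B [oB bB BVX' BVY']] : exists B : set (set T),
    [/\ forall b, B b -> open b,
        forall W s, open W -> W s -> exists2 b, B b & b s /\ b `<=` W,
        B #<= VX & B #<= VY].
  have [BXY|BYX] := card_le_total BX BY.
    by exists BX; split=> //; exact: card_le_trans BVY.
  by exists BY; split=> //; exact: card_le_trans BVX.
(* Images carry the base from the subspace to sets of functions without raising its cardinality. *)
pose img (b : set T) : set (X * Y -> Z) := [set sval s | s in b].
have imB : img @` B #<= B by exact: card_image_le.
exists (img @` B); split; last first.
  by split; [exists VX|exists VY]; split=> //; exact: card_le_trans imB _.
split=> [_ [b Bb <-]|W oW s [Ks Ws]].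
  have [W [oW bW]] := cu_extension dm KS (oB b Bb).
  exists W; split=> //; apply/seteqP; split=> [_ [s bs <-]|s [Ks Ws]].
    by split; [exact: (svalP s)|exact/bW].
  by exists (exist _ s Ks) => //; exact/bW.
have [b Bb [bs bW]] := bB _ (exist _ s Ks) (open_cu_trace KS oW) Ws.
exists (img b); first by exists b.
split; first by exists (exist _ s Ks).
by move=> _ [t /bW Wt <-]; split=> //; exact: (svalP t).
Qed.
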